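(* Let $S=\{x_1,\dots,x_n\}$ be a factor closed set of $n$ distinct positive integers, and let $a,b$ be positive integers with $a\mid b$. Then, in the ring $M_n(\mathbb{Z})$, $$\big((x_i,x_j)^a\big)\,\big|\,\big((x_i,x_j)^b\big),\qquad \big((x_i,x_j)^a\big)\,\big|\,\big([x_i,x_j]^b\big),\qquad \big([x_i,x_j]^a\big)\,\big|\,\big([x_i,x_j]^b\big).$$
   Context: $(x,y)$ denotes the greatest common divisor and $[x,y]$ the least common multiple; $((x_i,x_j)^a)$ and $([x_i,x_j]^a)$ denote the $n\times n$ matrices with $(i,j)$-entries $(x_i,x_j)^a$ and $[x_i,x_j]^a$. For $A,B\in M_n(\mathbb{Z})$, $A\mid B$ means there is $C\in M_n(\mathbb{Z})$ with $B=AC$ or $B=CA$. A set $S$ of positive integers is factor closed if every positive divisor of every element of $S$ lies in $S$. *)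

(* Defs.v *)
From mathcomp Require Import all_boot all_order all_algebra.

Set Implicit Arguments.
Unset Strict Implicit.
Unset Printing Implicit Defensive.

Import GRing.Theory.
Local Open Scope ring_scope.

Definition factor_closed (S : seq nat) : Prop :=
  forall s d : nat, s \in S -> (0 < d)%N -> (d %| s)%N -> d \in S.

Definition power_gcd_mx (n : nat) (x : 'I_n -> nat) (a : nat) : 'M[int]_n :=
  \matrix_(i, j) ((gcdn (x i) (x j) ^ a)%N)%:Z.

Definition power_lcm_mx (n : nat) (x : 'I_n -> nat) (a : nat) : 'M[int]_n :=
  \matrix_(i, j) ((lcmn (x i) (x j) ^ a)%N)%:Z.

(* Either one-sided factorization is accepted: M_n(Z) is not commutative. *)
Definition dvdmx (n : nat) (A B : 'M[int]_n) : Prop :=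
  exists C : 'M[int]_n, B = A *m C \/ B = C *m A.

(* Main.v *)
(* Write b = (c+1) a.  The entries of all the matrices are products over the
   primes p of functions of the p-adic valuations of x_i and x_j, so a
   factorization A = L D L^T, B = L D U of the matrices indexed by the divisors
   of one p-power multiplies up to a factorization of the matrices on S, the sum
   over the divisors of x_i being a sum over S because S is factor closed.  The
   factor L is triangular for divisibility with unit diagonal, hence invertible
   over the integers, and B = A (L^-T U).  With y = p^a, integral local factors
   are given by explicit polynomials in y. *)

Require Import Defs.
From mathcomp Require Import all_boot all_order all_algebra all_fingroup.
From mathcomp Require Import zify ring.

Set Implicit Arguments.
Unset Strict Implicit.
Unset Printing Implicit Defensive.

Import GRing.Theory.
Local Open Scope ring_scope.

(** * Divisor sums and Euler products *)

Lemma perm_divisors_coprime_mul (p k m : nat) :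
  prime p -> (0 < m)%N -> coprime p m ->
  perm_eq (divisors (m * p ^ k)) [seq (p ^ i * d)%N | i <- iota 0 k.+1, d <- divisors m].
Proof.
move=> p_pr m_gt0 co_pm.
have pk_gt0 i : (0 < p ^ i)%N by rewrite expn_gt0 prime_gt0.
have logE i d : (d %| m)%N -> logn p (p ^ i * d) = i.
  move=> d_m; rewrite lognM ?pk_gt0 ?(dvdn_gt0 _ d_m) // pfactorK //.
  by rewrite logn_coprime ?addn0 // (coprime_dvdr d_m).
apply: uniq_perm; first exact: divisors_uniq.
  apply: allpairs_uniq; rewrite ?iota_uniq ?divisors_uniq //.
  move=> _ _ /allpairsP[[i d] [_ d_m ->]] /allpairsP[[j e] [_ e_m ->]] /= E.
  rewrite -!dvdn_divisors // in d_m e_m.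
  have Eij : i = j by rewrite -(logE i d) // E logE.
  by move/eqP: E; rewrite Eij eqn_pmul2l ?pk_gt0 // => /eqP->.
move=> c; rewrite -dvdn_divisors ?muln_gt0 ?m_gt0 ?pk_gt0 //.
apply/idP/allpairsP => [c_mp | [[i d] []]].
  have c_gt0 : (0 < c)%N by apply: dvdn_gt0 c_mp; rewrite muln_gt0 m_gt0 pk_gt0.
  have [d co_pd def_c] := pfactor_coprime p_pr c_gt0.
  exists (logn p c, d); split.
  - have := dvdn_leq_log p _ c_mp; rewrite muln_gt0 m_gt0 pk_gt0 => /(_ isT).
    by rewrite logn_Gauss // pfactorK // mem_iota add0n ltnS.
  - rewrite /= -dvdn_divisors // -(@Gauss_dvdl d m (p ^ k)).
      by apply: dvdn_trans c_mp; rewrite def_c dvdn_mulr.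
    by rewrite coprimeXr // coprime_sym.
  - by rewrite mulnC.
rewrite mem_iota add0n ltnS -dvdn_divisors // => /= i_k d_m ->.
by rewrite mulnC dvdn_mul // dvdn_exp2l.
Qed.

(* The Euler product, over all [p < N] rather than the primes only: at a
   non-prime [p] the exponent [logn p d] is [0]. *)
Lemma sum_divisors_prod (R : comPzRingType) (N e : nat) (u : nat -> nat -> R) :
  (0 < e)%N -> (forall p, prime p -> (p %| e)%N -> (p < N)%N) ->
  \sum_(d <- divisors e) \prod_(p < N) u p (logn p d) =
  \prod_(p < N) \sum_(k < (logn p e).+1) u p k.
Proof.
elim: N e => [|N IH] e e_gt0 e_lt.
  have -> : e = 1%N.
    apply/eqP; rewrite eqn_leq e_gt0 andbT leqNgt; apply/negP => e_gt1.
    by have := e_lt _ (pdiv_prime e_gt1) (pdiv_dvd e).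
  by rewrite !big_ord0 /divisors /= big_seq1 big_ord0.
rewrite big_ord_recr /=; have [N_pr | N_npr] := boolP (prime N).
(* Split off the [N]-part: the divisors of [m * N ^ k] are the [N ^ i * d] with [d] dividing [m],
   and the primes of [m] lie below [N]. *)
- have [m co_Nm def_e] := pfactor_coprime N_pr e_gt0.
  have m_gt0 : (0 < m)%N by move: e_gt0; rewrite def_e muln_gt0 => /andP[].
  set k := logn N e in def_e *.
  have Nk_gt0 i : (0 < N ^ i)%N by rewrite expn_gt0 prime_gt0.
  have logE (p : 'I_N) i d : (0 < d)%N -> logn p (N ^ i * d) = logn p d.
    move=> d_gt0; rewrite lognM ?Nk_gt0 // lognX.
    by rewrite logn_prime // (ltn_eqF (ltn_ord p)) muln0.
  transitivity ((\sum_(d <- divisors m) \prod_(p < N) u p (logn p d)) *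
                \sum_(i < k.+1) u N i).
    rewrite def_e (perm_big _ (perm_divisors_coprime_mul k N_pr m_gt0 co_Nm)).
    rewrite [LHS]big_allpairs_dep /= -[0%N :: _]/(iota 0 k.+1) -[iota 0 k.+1]/(index_iota 0 k.+1) big_mkord.
    rewrite mulr_sumr.
    apply: eq_bigr => i _; rewrite mulr_suml big_seq [RHS]big_seq.
    apply: eq_bigr => d; rewrite -dvdn_divisors // => d_m.
    have d_gt0 := dvdn_gt0 m_gt0 d_m.
    rewrite big_ord_recr /=; congr (_ * _).
      by apply: eq_bigr => p _; rewrite logE.
    rewrite lognM ?Nk_gt0 // pfactorK // logn_coprime ?addn0 //.
    exact: coprime_dvdr d_m co_Nm.
  rewrite IH //; last first.
    move=> p p_pr p_m; have := e_lt p p_pr; rewrite def_e dvdn_mulr // => /(_ isT).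
    rewrite ltnS leq_eqVlt => /predU1P[Ep|//].
    by move: co_Nm; rewrite -Ep prime_coprime // p_m.
  congr (_ * _); apply: eq_bigr => p _.
  by rewrite def_e mulnC logE.
- have logN d : logn N d = 0%N by rewrite lognE (negPf N_npr).
  rewrite logN big_ord1 -IH //; last first.
    move=> p p_pr p_e; have := e_lt p p_pr p_e.
    by rewrite ltnS leq_eqVlt => /predU1P[Ep|//]; rewrite -Ep p_pr in N_npr.
  rewrite mulr_suml; apply: eq_bigr => d _.
  by rewrite big_ord_recr /= logN.
Qed.

Lemma prod_pfactor_lt (N m : nat) :
  (0 < m)%N -> (forall p, prime p -> (p %| m)%N -> (p < N)%N) ->
  (\prod_(p < N) p ^ logn p m)%N = m.
Proof.
move=> m_gt0 m_lt; rewrite -[RHS]partnT //.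
(* [N] and [m] are not comparable in general; [N + m] bounds both, and the factors from [N] on are
   1. *)
rewrite (@widen_partn (N + m)) ?leq_addl // (@big_cat_nat _ _ _ N) //=; last first.
  by rewrite -addnS leq_addr.
rewrite big_mkord [X in (_ * X)%N]big1_seq ?muln1 // => p.
rewrite mem_index_iota => /and3P[_ N_p _].
have [p_pr | p_npr] := boolP (prime p); last by rewrite lognE (negPf p_npr).
rewrite (_ : logn p m = 0%N) //; apply/eqP; rewrite -leqn0 leqNgt logn_gt0.
by rewrite mem_primes m_gt0 p_pr /=; apply/negP => /(m_lt _ p_pr); rewrite ltnNge N_p.
Qed.

(** The rows need not be sorted by [w]. A permutation [s] with a nonzero term has [w (s i) <= w i]
    for all [i]; both sides have the same sum, so equality holds throughout and injectivity gives
    [s = 1]. *)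
Lemma det_trig_wrt (R : comNzRingType) (n : nat) (w : 'I_n -> nat) (A : 'M[R]_n) :
  injective w -> (forall i j, ~~ (w j <= w i)%N -> A i j = 0) ->
  \det A = \prod_i A i i.
Proof.
move=> w_inj A0; rewrite /determinant (bigD1 (1%g : 'S_n)) //= [X in _ + X]big1 => [|s s1].
  by rewrite odd_perm1 expr0 mul1r addr0; apply: eq_bigr => i _; rewrite perm1.
have [/forallP le_s | ] := boolP [forall i, (w (s i) <= w i)%N]; last first.
  by case/forallPn=> i /A0 Ai0; rewrite (bigD1 i) //= Ai0 mul0r mulr0.
case/eqP: s1; apply/permP => i; rewrite perm1; apply: w_inj.
have le_s' j : true -> (w (s j) <= w j ?= iff (w (s j) == w j))%N by split.
have [_] := leqif_sum le_s'.
by rewrite [X in _ == X](reindex_perm s) eqxx => /esym/forallP/(_ i)/eqP.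
Qed.

(** * From local factorizations to matrices on a factor closed set *)

Section FactorClosed.

Variables (n : nat) (x : 'I_n -> nat).
Hypotheses (x_inj : injective x) (x_gt0 : forall i, (0 < x i)%N).
Hypothesis x_closed : factor_closed (codom x).

(** This is where factor closedness enters: each divisor of [x i] is some [x j]. *)
Lemma sum_factor_closed (R : nmodType) (F : nat -> R) (i : 'I_n) :
  \sum_(j | (x j %| x i)%N) F (x j) = \sum_(d <- divisors (x i)) F d.
Proof.
have -> : \sum_(j | (x j %| x i)%N) F (x j) =
          \sum_(d <- [seq x j | j <- enum 'I_n & (x j %| x i)%N]) F d.
  by rewrite big_map big_filter big_enum_cond.
apply: perm_big; apply: uniq_perm; rewrite ?divisors_uniq //.
  by rewrite map_inj_uniq // filter_uniq // enum_uniq.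
move=> d; rewrite -dvdn_divisors //; apply/mapP/idP => [[j]|d_x].
  by rewrite mem_filter => /andP[? _] ->.
have /codomP[j def_d] := x_closed (codom_f x i) (dvdn_gt0 (x_gt0 i) d_x) d_x.
by exists j; rewrite // mem_filter -def_d d_x mem_enum.
Qed.

(** [f] and [g] share the left factors [t] and [phi], so only the unimodular [T^T] is inverted,
    never the diagonal matrix. *)
Lemma dvdmx_of_local (N : nat) (f g t w : nat -> nat -> nat -> int) (phi : nat -> nat -> int) :
    (forall i p, prime p -> (p %| x i)%N -> (p < N)%N) ->
    (forall p K, t p K K = 1) -> (forall p K k, (K < k)%N -> t p K k = 0) ->
    (forall p K v, f p K v = \sum_(k < K.+1) t p K k * phi p k * t p v k) ->
    (forall p K v, g p K v = \sum_(k < K.+1) t p K k * phi p k * w p k v) ->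
  dvdmx (\matrix_(i, j) \prod_(p < N) f p (logn p (x i)) (logn p (x j)))
        (\matrix_(i, j) \prod_(p < N) g p (logn p (x i)) (logn p (x j))).
Proof.
move=> x_lt t1 t0 fE gE.
have log_lt i j : ~~ (x j %| x i)%N -> exists p : 'I_N, (logn p (x i) < logn p (x j))%N.
  move=> ndvd; apply/existsP; apply: contraR ndvd => /existsPn /= le_log.
  rewrite -(prod_pfactor_lt (x_gt0 j) (x_lt j)) -(prod_pfactor_lt (x_gt0 i) (x_lt i)).
  apply: (big_ind2 (fun a b => a %| b)%N) => // [? ? ? ?|p _]; first exact: dvdn_mul.
  by apply: dvdn_exp2l; rewrite leqNgt.
pose T : 'M[int]_n := \matrix_(i, j) \prod_(p < N) t p (logn p (x i)) (logn p (x j)).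
pose D := diag_mx (\row_j \prod_(p < N) phi p (logn p (x j))) : 'M[int]_n.
have TDE (h s : nat -> nat -> nat -> int) :
    (forall p K v, h p K v = \sum_(k < K.+1) t p K k * phi p k * s p k v) ->
  \matrix_(i, j) \prod_(p < N) h p (logn p (x i)) (logn p (x j)) =
  T *m D *m \matrix_(i, j) \prod_(p < N) s p (logn p (x i)) (logn p (x j)).
  move=> hE; apply/matrixP => i j; rewrite /D mul_mx_diag !mxE.
  under eq_bigr do rewrite hE.
  rewrite -(@sum_divisors_prod _ N (x i) (fun p k =>
    t p (logn p (x i)) k * phi p k * s p k (logn p (x j)))) //; last exact: x_lt.
  (* The matrix product runs over all [k], the divisor sum only over [x k] dividing [x i]; the other
     terms vanish by [log_lt] and [t0]. *)
  rewrite -sum_factor_closed big_mkcond /=; apply: eq_bigr => k _.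
  rewrite !mxE -!big_split /=; case: ifP => // /negbT ndvd.
  by have [p lt_p] := log_lt _ _ ndvd; rewrite (bigD1 p) //= t0 // !mul0r.
have Tunit : T^T \in unitmx.
  rewrite unitmx_tr unitmxE (det_trig_wrt x_inj).
    by rewrite big1 ?unitr1 // => i _; rewrite mxE big1.
  move=> i j lt_ij; rewrite mxE.
  have [p lt_p] := log_lt i j (contra (dvdn_leq (x_gt0 i)) lt_ij).
  by rewrite (bigD1 p) //= t0 // mul0r.
rewrite (TDE _ _ gE) (TDE f (fun p k v => t p v k) fE).
set U := (X in dvdmx (_ *m X)); set W := (X in dvdmx _ (_ *m X)).
have -> : U = T^T by apply/matrixP => i j; rewrite !mxE.
by exists (invmx T^T *m W); left; rewrite -!mulmxA mulKVmx.
Qed.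

End FactorClosed.

(** * Explicit factorizations at one prime *)

Section Local.

Variables (R : comPzRingType) (y : R).

(* [lgcd], [dgcd] are the entries of [L], [D] for the matrix [y ^+ minn K v];
   [llcm], [dlcm] are those for [y ^+ maxn K v].  The factor [U] is [ugcd_gcd]
   (resp. [ugcd_lcm]) for the target [y ^+ (c.+1 * minn K v)]
   (resp. [y ^+ (c.+1 * maxn K v)]) divided by the gcd matrix, and [ulcm_lcm] for
   the target [y ^+ (c.+1 * maxn K v)] divided by the lcm matrix. *)
Definition geom (c : nat) : R := \sum_(i < c) y ^+ i.

Definition lgcd (K k : nat) : R := (k <= K)%:R.

Definition dgcd (k : nat) : R := if k is k'.+1 then y ^+ k' * (y - 1) else 1.

Definition ugcd_gcd (c k v : nat) : R :=
  if k is k'.+1 then lgcd v k * (y ^+ (c * k') * geom c.+1) else 1.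

Definition ugcd_lcm (c k v : nat) : R :=
  if k is k'.+1 then (v <= k')%:R * (y ^+ (c * k') * geom c.+1) else y ^+ (c.+1 * v).

Definition llcm (K k : nat) : R := if (k <= K)%N then y ^+ (K - k) else 0.

Definition dlcm (k : nat) : R := if k is k'.+1 then y ^+ k * (1 - y) else 1.

Definition ulcm_lcm (c k v : nat) : R :=
  if k is k'.+1 then
    if (k <= v)%N then y ^+ (c.+1 * v - k) else - (y ^+ (c * k') * geom c)
  else y ^+ (c.+1 * v).

Lemma sum_lgcd (F G : nat -> R) (K : nat) :
  \sum_(k < K.+1) lgcd K k * F k * G k = \sum_(k < K.+1) F k * G k.
Proof. by apply: eq_bigr => k _; rewrite /lgcd -ltnS ltn_ord mul1r. Qed.

(** The sum telescopes: for [0 < k <= v] the term is [y ^+ (c.+1 * k) - y ^+ (c.+1 * k.-1)], and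
    beyond [v] it is 0. *)
Lemma gcd_gcd_local (c K v : nat) :
  y ^+ (c.+1 * minn K v) = \sum_(k < K.+1) lgcd K k * dgcd k * ugcd_gcd c k v.
Proof.
rewrite (sum_lgcd dgcd (ugcd_gcd c ^~ v)).
elim: K => [|K IH]; first by rewrite min0n muln0 big_ord1 mulr1.
rewrite big_ord_recr -IH /= /lgcd; case: ltnP => [lt_Kv | le_vK].
  rewrite (minn_idPl lt_Kv) mul1r.
  rewrite mulrACA -subrX1 -exprD -mulSn mulrBr mulr1 -exprD -mulnSr.
  by rewrite addrC subrK.
by rewrite (minn_idPr (leqW le_vK)) mul0r mulr0 addr0.
Qed.

(** The complementary telescoping: it starts at [y ^+ (c.+1 * v)] and gains the same differences
    only for [k > v]. *)
Lemma gcd_lcm_local (c K v : nat) :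
  y ^+ (c.+1 * maxn K v) = \sum_(k < K.+1) lgcd K k * dgcd k * ugcd_lcm c k v.
Proof.
rewrite (sum_lgcd dgcd (ugcd_lcm c ^~ v)).
elim: K => [|K IH]; first by rewrite max0n big_ord1 mul1r.
rewrite big_ord_recr -IH /=; case: leqP => [le_vK | lt_Kv].
  rewrite (maxn_idPl (leqW le_vK)) mul1r.
  rewrite mulrACA -subrX1 -exprD -mulSn mulrBr mulr1 -exprD -mulnSr.
  by rewrite addrC subrK.
by rewrite (maxn_idPr lt_Kv) mul0r mulr0 addr0.
Qed.

(** Passing from [K] to [K.+1] multiplies every old term by [y], so the new term must be the target
    at [K.+1] minus [y] times the target at [K]; dividing this by [dlcm K.+1] yields [ulcm_lcm]. *)
Lemma lcm_lcm_local (c K v : nat) :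
  y ^+ (c.+1 * maxn K v) = \sum_(k < K.+1) llcm K k * dlcm k * ulcm_lcm c k v.
Proof.
elim: K => [|K IH]; first by rewrite max0n big_ord1 /llcm /= !mul1r.
have llcmS (k : 'I_K.+1) : llcm K.+1 k = y * llcm K k.
  by have le_kK := ltn_ord k; rewrite ltnS in le_kK; rewrite /llcm leqW // le_kK subSn // exprS.
rewrite big_ord_recr /=; under eq_bigr do rewrite llcmS -2!mulrA [llcm _ _ * _]mulrA.
rewrite -mulr_sumr -IH /llcm leqnn subnn mul1r; case: ltnP => [lt_Kv | le_vK].
  rewrite (maxn_idPr lt_Kv).
  have -> : y ^+ (c.+1 * v) = y ^+ K.+1 * y ^+ (c.+1 * v - K.+1).
    by rewrite -exprD subnKC // (leq_trans lt_Kv) // leq_pmull.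
  ring.
rewrite (maxn_idPl (leqW le_vK)).
have -> : y ^+ K.+1 * (1 - y) * - (y ^+ (c * K) * geom c) =
          y ^+ K.+1 * y ^+ (c * K) * ((y - 1) * geom c) by ring.
rewrite -subrX1 -!exprD -exprS mulrBr mulr1 -exprD addrC.
have -> : (K.+1 + c * K + c = c.+1 * K.+1)%N by lia.
have -> : (K.+1 + c * K = (c.+1 * K).+1)%N by lia.
by rewrite subrK.
Qed.

(** At [c = 0] the target is the source matrix, and the factorization becomes the symmetric
    [L D L^T]. *)
Lemma ugcd_gcd0 (k v : nat) : ugcd_gcd 0 k v = lgcd v k.
Proof. by case: k => [|k] //=; rewrite /geom big_ord1 mul0n !mulr1. Qed.

Lemma ulcm_lcm0 (k v : nat) : ulcm_lcm 0 k v = llcm v k.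
Proof.
by case: k => [|k] /=; rewrite /llcm ?mul1n ?subn0 // /geom big_ord0 mulr0 oppr0.
Qed.

End Local.

(** * Assembling the primes *)

Lemma exp_prod_pfactor_lt (N m a c : nat) :
  (0 < m)%N -> (forall p, prime p -> (p %| m)%N -> (p < N)%N) ->
  ((m ^ (c * a))%N)%:Z = \prod_(p < N) (p ^ a)%N%:Z ^+ (c * logn p m).
Proof.
move=> m_gt0 m_lt; rewrite -{1}(prod_pfactor_lt m_gt0 m_lt) -natz natrX natr_prod -prodrXl.
apply: eq_bigr => p _; rewrite -natz !natrX -!exprM; congr (_ ^+ _); lia.
Qed.

Theorem theorem3p1 (n : nat) (x : 'I_n -> nat) (a b : nat)
    (x_inj : injective x) (x_gt0 : forall i : 'I_n, (0 < x i)%N)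
    (x_closed : factor_closed (codom x))
    (a_gt0 : (0 < a)%N) (b_gt0 : (0 < b)%N) (a_dvd_b : (a %| b)%N) :
  [/\ dvdmx (power_gcd_mx x a) (power_gcd_mx x b),
      dvdmx (power_gcd_mx x a) (power_lcm_mx x b) &
      dvdmx (power_lcm_mx x a) (power_lcm_mx x b)].
Proof.
have [[|c] def_b] := dvdnP a_dvd_b; first by rewrite def_b in b_gt0.
pose N := (\max_i x i).+1.
have x_lt i p : prime p -> (p %| x i)%N -> (p < N)%N.
  by move=> _ p_x; rewrite ltnS (leq_trans (dvdn_leq _ p_x)) // leq_bigmax.
pose y p := (p ^ a)%N%:Z.
have gcdE e : power_gcd_mx x (e.+1 * a) = \matrix_(i, j)
    \prod_(p < N) y p ^+ (e.+1 * minn (logn p (x i)) (logn p (x j))).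
  apply/matrixP => i j; rewrite !mxE (@exp_prod_pfactor_lt N).
  - by apply: eq_bigr => p _; rewrite logn_gcd.
  - by rewrite gcdn_gt0 x_gt0.
  - by move=> p p_pr; rewrite dvdn_gcd => /andP[/(x_lt _ _ p_pr)].
have lcmE e : power_lcm_mx x (e.+1 * a) = \matrix_(i, j)
    \prod_(p < N) y p ^+ (e.+1 * maxn (logn p (x i)) (logn p (x j))).
  apply/matrixP => i j; rewrite !mxE (@exp_prod_pfactor_lt N).
  - by apply: eq_bigr => p _; rewrite logn_lcm.
  - by rewrite lcmn_gt0 !x_gt0.
  - move=> p p_pr p_lcm.
    have : (p %| x i * x j)%N.
      by apply: dvdn_trans p_lcm _; rewrite dvdn_lcm dvdn_mulr ?dvdn_mull.
    by rewrite Euclid_dvdM // => /orP[] /(x_lt _ _ p_pr).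
have lgcd_diag K : lgcd int K K = 1 by rewrite /lgcd leqnn.
have lgcd_trig K k : (K < k)%N -> lgcd int K k = 0 by rewrite /lgcd ltnNge => /negPf->.
have llcm_diag p K : llcm (y p) K K = 1 by rewrite /llcm leqnn subnn.
have llcm_trig p K k : (K < k)%N -> llcm (y p) K k = 0.
  by rewrite /llcm ltnNge => /negPf->.
have gcd_local p K v : y p ^+ (1 * minn K v) =
    \sum_(k < K.+1) lgcd _ K k * dgcd (y p) k * lgcd _ v k.
  by rewrite gcd_gcd_local; apply: eq_bigr => k _; rewrite ugcd_gcd0.
have lcm_local p K v : y p ^+ (1 * maxn K v) =
    \sum_(k < K.+1) llcm (y p) K k * dlcm (y p) k * llcm (y p) v k.
  by rewrite lcm_lcm_local; apply: eq_bigr => k _; rewrite ulcm_lcm0.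
(* Writing [a] as [1 * a] makes the sources the case [e = 0] of [gcdE] and [lcmE], and the targets
   the case [e = c]. *)
rewrite def_b -[a]mul1n mulnA muln1 !gcdE !lcmE; split.
- exact: (dvdmx_of_local (t := fun=> lgcd int) (phi := fun p => dgcd (y p))
    (w := fun p => ugcd_gcd (y p) c) x_inj x_gt0 x_closed x_lt
    (fun=> lgcd_diag) (fun=> lgcd_trig) gcd_local (fun p => gcd_gcd_local (y p) c)).
- exact: (dvdmx_of_local (t := fun=> lgcd int) (phi := fun p => dgcd (y p))
    (w := fun p => ugcd_lcm (y p) c) x_inj x_gt0 x_closed x_lt
    (fun=> lgcd_diag) (fun=> lgcd_trig) gcd_local (fun p => gcd_lcm_local (y p) c)).
- exact: (dvdmx_of_local (t := fun p => llcm (y p)) (phi := fun p => dlcm (y p))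
    (w := fun p => ulcm_lcm (y p) c) x_inj x_gt0 x_closed x_lt
    llcm_diag llcm_trig lcm_local (fun p => lcm_lcm_local (y p) c)).
Qed.
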